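(* Let $(X,P)$ be an irreducible random walk. Then there exists a finite variation, stationary (signed) measure $\nu \not\equiv 0$ on $X$ if and only if $(X,P)$ is positive recurrent. In this case, for such a $\nu$, there exists $\alpha \in \mathbb{R} \setminus \{0\}$ such that $\nu = \alpha \mu$, where $\mu$ satisfies $$\mu(y) = \frac{1}{d} \limsup_{n \to \infty} p^{(nd + j - i)}(x,y), \qquad y \in X,$$ where $d$ is the period of the random walk and $i, j$ are the indices of the periodicity classes with $x \in C_i$ and $y \in C_j$; the right-hand side is independent of $x \in X$.
   Context: A random walk $(X,P)$ is a time-homogeneous Markov chain $\{Z_n\}_{n\in\mathbb{N}}$ with finite or countable state space $X$ and $1$-step transition probabilities $p(x,y) = \mathbb{P}[Z_1 = y \mid Z_0 = x]$, so $p(x,y) \ge 0$ and $\sum_{y \in X} p(x,y) = 1$ for every $x$. Write $p^{(n)}(x,y) = \mathbb{P}[Z_n = y \mid Z_0 = x]$. The walk is irreducible if for all $x,y \in X$ there is $n$ with $p^{(n)}(x,y) > 0$. The period of an irreducible random walk is $d = \gcd\{ n \ge 1 : p^{(n)}(x,x) > 0 \}$, which does not depend on $x$; the periodicity classes $C_0, C_1, \dots, C_{d-1}$ (with $C_d \equiv C_0$) form the partition of $X$ such that $p(x,y) > 0$ and $x \in C_i$ imply $y \in C_{i+1}$ (indices modulo $d$). An irreducible random walk is positive recurrent if it is recurrent and the expected return time to each state (equivalently, some state) is finite. A signed measure $\nu$ on $X$ is identified with the function $x \mapsto \nu(x) = \nu(\{x\}) \in \mathbb{R}$; it has finite variation if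 $\nu \in l^1(X)$, i.e. $\sum_{x \in X} |\nu(x)| < \infty$. It is stationary if $(Q\nu)(y) = \nu(y)$ for all $y \in X$, where $(Q\nu)(y) := \sum_{x \in X} p(x,y)\,\nu(x)$. *)

(* Defs.v *)
From HB Require Import structures.
From mathcomp Require Import all_boot all_order all_algebra.
From mathcomp Require Import all_classical all_reals all_analysis.

Set Implicit Arguments.
Unset Strict Implicit.
Unset Printing Implicit Defensive.
Import Order.TTheory GRing.Theory Num.Theory.
Import numFieldNormedType.Exports.

Local Open Scope classical_set_scope.
Local Open Scope ring_scope.

(* [Pr x] is the law of the chain started at [x], i.e. P[ . | Z_0 = x].  [X]
   carries the discrete sigma-algebra and is countable, so measurability of
   [Z n] is stated on singletons.  The field [markov] is the time-homogeneous
   Markov property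
     P_x[Z_{n+1} = s_{n+1} | Z_0 = s_0, ..., Z_n = s_n] = p(s_n, s_{n+1})
   multiplied out, so that histories of probability 0 need no side condition. *)
Record randomWalk (R : realType) (X : countType) (d : measure_display)
    (Omega : measurableType d) := RandomWalk {
  p : X -> X -> R ;
  p_ge0 : forall x y, 0 <= p x y ;
  p_sum1 : forall x, (\esum_(y in [set: X]) (p x y)%:E = 1)%E ;
  Pr : X -> probability Omega R ;
  Z : nat -> Omega -> X ;
  measurable_Z : forall n y, measurable [set w | Z n w = y] ;
  start : forall x, Pr x [set w | Z 0 w = x] = 1%E ;
  markov : forall x n (s : nat -> X),
    Pr x [set w | forall k, (k <= n.+1)%N -> Z k w = s k] =
    (Pr x [set w | forall k, (k <= n)%N -> Z k w = s k]
       * (p (s n) (s n.+1))%:E)%E }.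

Section RandomWalk.
Context {R : realType} {X : countType} {d : measure_display}
  {Omega : measurableType d}.
Implicit Type W : randomWalk R X Omega.

Definition pn W (n : nat) (x y : X) : \bar R := Pr W x [set w | Z W n w = y].

Definition irreducible W : Prop := forall x y, exists n, (0 < pn W n x y)%E.

Definition is_gcd (A : set nat) (g : nat) : Prop :=
  (forall n, A n -> (g %| n)%N) /\
  (forall e, (forall n, A n -> (e %| n)%N) -> (e %| g)%N).

Definition is_period W (g : nat) : Prop :=
  forall x, is_gcd [set n | (1 <= n)%N /\ (0 < pn W n x x)%E] g.

(* [ordS i] is [i + 1] modulo [g]. *)
Definition periodicity_classes W (g : nat) (C : 'I_g -> set X) : Prop :=
  partition [set: 'I_g] C [set: X] /\
  (forall i x y, C i x -> 0 < p W x y -> C (ordS i) y).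

(* First return time, equal to +oo on trajectories that never return. *)
Definition return_time W (x : X) (w : Omega) : \bar R :=
  ereal_inf [set (n%:R)%:E | n in [set n | (1 <= n)%N /\ Z W n w = x]].

Definition recurrent W : Prop :=
  forall x, Pr W x [set w | exists n, (1 <= n)%N /\ Z W n w = x] = 1%E.

Definition positive_recurrent W : Prop :=
  recurrent W /\ forall x, (\int[Pr W x]_w return_time W x w < +oo)%E.

Definition finite_variation (nu : X -> R) : Prop :=
  summable [set: X] (EFin \o nu).

(* Sum over a countable type of a signed family, the library's [\esum] being
   meant for nonnegative ones; meaningful when the family is summable. *)
Definition ssum (f : X -> R) : \bar R :=
  (\esum_(x in [set: X]) (EFin \o f)^\+ x
   - \esum_(x in [set: X]) (EFin \o f)^\- x)%E.

Definition stationary W (nu : X -> R) : Prop :=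
  forall y, ssum (fun x => p W x y * nu x) = (nu y)%:E.

End RandomWalk.

(* Main.v *)
Require Import Defs.
From HB Require Import structures.
From mathcomp Require Import all_boot all_order all_algebra.
From mathcomp Require Import lra.
From mathcomp Require Import all_classical all_reals all_analysis.

Set Implicit Arguments.
Unset Strict Implicit.
Unset Printing Implicit Defensive.
Import Order.TTheory GRing.Theory Num.Theory.
Import numFieldNormedType.Exports.

Local Open Scope classical_set_scope.
Local Open Scope ring_scope.

(** Write [T_y] for the first return time to [y], and [f_n(x)] for the
    probability that the walk started at [x] misses [y] at times [1, ..., n].
    A nonnegative invariant measure [t] of finite mass satisfies, by splitting
    its mass according to the last visit to [y] before time [n],
      [t(y) (f_0(y) + ... + f_(n-1)(y)) + sum_x t(x) f_n(x) = sum_x t(x)]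
    ([invariant_last_visit]).  The first sum increases to the expectation of
    [T_y] under the law started at [y], so [t(y) > 0] forces positive
    recurrence.  Once this expectation is finite, irreducibility makes [f_n]
    tend to [0] everywhere, the second sum vanishes in the limit, and
    [t(y) = t(X) / E_y T_y] ([invariant_mean_return]): up to a factor, [t] is
    the measure [y |-> 1 / E_y T_y], called [kac_measure] below.  A signed
    stationary measure of finite variation reduces to this case because its
    positive and negative parts are separately invariant ([stationary_parts]).
    Conversely, under positive recurrence, the expected number of visits
    during an excursion from a fixed state is an invariant measure
    ([invariant_occupation]).

    For the upper limits, let [mu] be [kac_measure], fix [y], and put
    [l = limsup p^(n)(y,y)].  Stopping the walk when it reaches [y] shows that
    [limsup p^(n)(x,y) <= l] for all [x] ([limn_esup_pn_le]).  Since
    [p^(m+n)(y,y)] is an average of the numbers [p^(n)(z,y)] with weights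
    [p^(m)(y,z)], it can be close to [l] only if [p^(n)(z,y)] is close to [l]
    whenever [p^(m)(y,z) > 0] ([near_limsup_propagates]).  Every state [z] in
    the periodicity class of [y] is reached from [y] at all large multiples of
    the period [d], so [p^(n)(z,y)] is close to [l] simultaneously for all [z]
    in any given finite part of the class, for suitable [n].  Insert this in
    [sum_x mu(x) p^(n)(x,y) = mu(y)]: as each of the [d] classes has mass
    [1/d], it follows that [l / d <= mu(y)].  The reverse Fatou inequality in
    the same identity gives [mu(y) <= l / d]. *)

(** * Sums of nonnegative families *)

Section Esum.
Context {R : realType}.
Local Open Scope ereal_scope.

Lemma ge0_le0_eq0 (x : \bar R) : 0 <= x -> x <= 0 -> x = 0.
Proof. by move=> x0 x0'; apply/eqP; rewrite eq_le x0 x0'. Qed.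

Lemma esum_ge_term (T : choiceType) (A : set T) (a : T -> \bar R) (x : T) :
  (forall y, A y -> 0 <= a y) -> A x -> a x <= \esum_(y in A) a y.
Proof.
move=> a0 Ax; rewrite -(esum_set1 (a0 _ Ax)); apply: ereal_sup_le.
by move=> _ [F [finF FA] <-]; exists F => //; split => // y /FA ->.
Qed.

Lemma esum_subset (T : choiceType) (A B : set T) (a : T -> \bar R) :
  A `<=` B -> \esum_(y in A) a y <= \esum_(y in B) a y.
Proof.
move=> AB; apply: ereal_sup_le => _ [F [finF FA] <-]; exists F => //.
by split => // y /FA /AB.
Qed.

Lemma esum_split (T : choiceType) (a : T -> \bar R) (x : T) :
  (forall y, 0 <= a y) ->
  \esum_(y in setT) a y = a x + \esum_(y in ~` [set x]) a y.
Proof.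
by move=> a0; rewrite (esumID [set x])// !setTI esum_set1.
Qed.

Lemma esum_single (T : choiceType) (a : T -> \bar R) (x : T) :
  0 <= a x -> (forall y, y != x -> a y = 0) -> \esum_(y in setT) a y = a x.
Proof.
move=> ax0 a0; rewrite (esum_split x); last first.
  by move=> y; have [->|/a0 ->] := eqVneq y x.
by rewrite esum1 ?adde0// => y /= /eqP /a0.
Qed.

(** No state can gain mass when none loses any and the finite total is
    unchanged; this turns sub- and superinvariance into invariance. *)
Lemma eq_of_le_esum_eq (T : choiceType) (a b : T -> \bar R) (x : T) :
  (forall y, 0 <= a y) -> \esum_(y in setT) a y < +oo ->
  (forall y, a y <= b y) ->
  \esum_(y in setT) b y = \esum_(y in setT) a y -> a x = b x.
Proof.
move=> a0 aoo ab bE; have b0 y : 0 <= b y by exact: le_trans (ab y).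
apply/eqP; rewrite eq_le ab/= leNgt; apply/negP => abx.
have tail_fin : \esum_(y in ~` [set x]) a y \is a fin_num.
  rewrite ge0_fin_numE ?esum_ge0//; apply: le_lt_trans aoo.
  exact: esum_subset.
have : \esum_(y in setT) a y < \esum_(y in setT) b y.
  rewrite (esum_split x a0) (esum_split x b0); apply: lte_leD => //.
  by apply: le_esum => y _; exact: ab.
by rewrite bE ltxx.
Qed.

Lemma esumZl (T : choiceType) (A : set T) (c : \bar R) (a : T -> \bar R) :
  0 <= c -> (forall y, 0 <= a y) ->
  \esum_(y in A) (c * a y) = c * \esum_(y in A) a y.
Proof.
move=> c0 a0; case: c c0 => [r r0|_|//].
- rewrite /esum -ereal_supZl//; last first.
    by apply/set0P; eexists; exists set0; first exact: fsets_set0.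
  congr ereal_sup; apply/seteqP; split.
    by move=> _ [F FA <-]; eexists; [by exists F|rewrite ge0_mule_fsumr].
  by move=> _ [_ [F FA <-] <-]; exists F => //; rewrite ge0_mule_fsumr.
- have [a_eq0|/existsNP[y /not_implyP[Ay /eqP ay]]] :=
    pselect (forall y, A y -> a y = 0).
    by rewrite !esum1 ?mule0// => y /a_eq0 ->; rewrite mule0.
  have ay0 : 0 < a y by rewrite lt_neqAle eq_sym ay a0.
  have sa0 : 0 < \esum_(y in A) a y.
    by apply: lt_le_trans ay0 _; exact: esum_ge_term.
  rewrite gt0_mulye//; apply/eqP; rewrite -leye_eq.
  have : +oo * a y <= \esum_(z in A) (+oo * a z).
    apply: (@esum_ge_term _ A (fun z => +oo * a z)) => // z _.
    by rewrite mule_ge0.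
  by rewrite gt0_mulye.
Qed.

Lemma esum_exchange (T1 T2 : choiceType) (A : set T1) (B : set T2)
    (a : T1 -> T2 -> \bar R) :
  (forall x y, 0 <= a x y) ->
  \esum_(x in A) \esum_(y in B) a x y = \esum_(y in B) \esum_(x in A) a x y.
Proof.
move=> a0; rewrite !esum_esum//.
have sw : set_bij (B `*`` (fun=> A)) (A `*`` (fun=> B)) (fun k => (k.2, k.1)).
  split=> [[y x] /= []//|[y x] [y' x'] _ _ /= [-> ->]//|[x y] /= [Ax By]].
  by exists (y, x).
by rewrite (@reindex_esum _ _ _ _ _ _ _ sw).
Qed.

(** * Upper limits *)

Lemma limn_esup_le_near (u : nat -> \bar R) (l : \bar R) :
  (\forall n \near \oo, u n <= l) -> limn_esup u <= l.
Proof.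
move=> [N _ uN]; rewrite limn_esup_lim.
apply: lime_le; first exact: is_cvg_esups.
exists N => // n /= Nn; apply: ge_ereal_sup => _ [k /= nk <-].
by apply: uN => /=; apply: leq_trans nk.
Qed.

Lemma near_lt_limn_esup (u : nat -> \bar R) (l : \bar R) :
  limn_esup u < l -> \forall n \near \oo, u n < l.
Proof.
rewrite limn_esup_lim (cvg_lim _ (@cvg_esups_inf R u))//.
move=> /ereal_inf_lt[_ [N _ <-]] supl; exists N => // n /= Nn.
by apply: le_lt_trans supl; apply: ereal_sup_ubound; exists n.
Qed.

Lemma limn_esup_subseq (u : nat -> \bar R) (f : nat -> nat) :
  (forall N, \forall n \near \oo, (N <= f n)%N) ->
  limn_esup (u \o f) <= limn_esup u.
Proof.
move=> foo; rewrite [leRHS]limn_esup_lim (cvg_lim _ (@cvg_esups_inf R u))//.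
apply: le_ereal_inf_tmp => _ [N _ <-]; apply: limn_esup_le_near.
have [M _ fN] := foo N; exists M => // n /fN Nfn.
by apply: ereal_sup_ubound; exists (f n).
Qed.

Lemma limn_esup_shift (u : nat -> \bar R) (m : nat) :
  limn_esup u <= limn_esup (fun n => u (n + m)%N).
Proof.
rewrite [leRHS]limn_esup_lim (cvg_lim _ (@cvg_esups_inf R _))//.
apply: le_ereal_inf_tmp => _ [N _ <-]; apply: limn_esup_le_near.
exists (N + m)%N => // n /= Nn; apply: ereal_sup_ubound.
exists (n - m)%N; rewrite /= ?subnK ?leq_subRL// ?(leq_trans _ Nn) ?leq_addl//.
by rewrite addnC.
Qed.

Lemma limn_esup_ge_frequently (u : nat -> \bar R) (l : \bar R) :
  (forall N, exists2 n, (N <= n)%N & l <= u n) -> l <= limn_esup u.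
Proof.
move=> ul; rewrite leNgt; apply/negP => /near_lt_limn_esup[N _ uN].
by have [n /uN /= /lt_geF ->] := ul N.
Qed.

Lemma frequently_lt_limn_esup (u : nat -> \bar R) (l : \bar R) :
  l < limn_esup u -> forall N, exists2 n, (N <= n)%N & l < u n.
Proof.
move=> lu N; apply: contrapT => /forall2NP nlu.
move: lu; apply/negP; rewrite -leNgt; apply: limn_esup_le_near.
by exists N => // n /= Nn; case: (nlu n) => // /negP; rewrite -leNgt.
Qed.

Lemma near_finite_set (T : choiceType) (F : set T) (P : T -> nat -> Prop) :
  finite_set F -> (forall x, F x -> \forall n \near \oo, P x n) ->
  \forall n \near \oo, forall x, F x -> P x n.
Proof.
move=> /finite_fsetP[G ->] nP.
suff : \oo (\bigcap_(x in [set i | i \in finmap.enum_fset G]) [set n | P x n]).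
  by apply: filterS => n Gn x Gx; exact: Gn.
by apply: filter_bigI => x xG; exact: nP.
Qed.

(** Reverse Fatou inequality: outside a finite set the weights [w] have small
    total, and [a n x <= 1] there; on the finite set the bounds hold
    simultaneously from some rank on. *)
Lemma limn_esup_esum_le (T : choiceType) (w : T -> \bar R)
    (a : nat -> T -> \bar R) (b : T -> \bar R) :
  (forall x, 0 <= w x) -> \esum_(x in setT) w x < +oo ->
  (forall n x, 0 <= a n x <= 1) -> (forall x, 0 <= b x) ->
  (forall x, limn_esup (a ^~ x) <= b x) ->
  limn_esup (fun n => \esum_(x in setT) (w x * a n x))
    <= \esum_(x in setT) (w x * b x).
Proof.
move=> w0 woo a01 b0 ab.
have a0 n x : 0 <= a n x by case/andP: (a01 n x).
have a1 n x : a n x <= 1 by case/andP: (a01 n x).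
have wa0 n x : 0 <= w x * a n x by rewrite mule_ge0.
have wb0 x : 0 <= w x * b x by rewrite mule_ge0.
apply/lee_addgt0Pr => e e0; apply: limn_esup_le_near.
set W := \esum_(x in setT) w x in woo.
have Wfin : W \is a fin_num by rewrite ge0_fin_numE// esum_ge0.
have W0 : (0 <= fine W)%R by rewrite fine_ge0// esum_ge0.
(* [dl] spends half of [e] over the whole mass [W]; the [+ 1] covers [W = 0] *)
pose dl := (e / 2 / (fine W + 1))%R.
have dl0 : (0 < dl)%R by rewrite !divr_gt0// ltr_wpDl.
have dlE0 : 0 <= dl%:E by rewrite lee_fin ltW.
have e20 : (0 < e / 2)%R by rewrite divr_gt0.
have [_ [F [finF _] <-]] := ub_ereal_sup_adherent e20 Wfin.
rewrite -[ereal_sup _]/W => WF.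
have tailF : \esum_(x in ~` F) w x <= (e / 2)%:E.
  have : W = \esum_(x in F) w x + \esum_(x in ~` F) w x.
    by rewrite /W (esumID F)// !setTI.
  rewrite esum_fset// => WE; move: WF; rewrite lteBlDr// WE => WF.
  have SF : \sum_(x \in F) w x \is a fin_num.
    rewrite ge0_fin_numE ?fsume_ge0//; apply: le_lt_trans woo.
    by rewrite WE leeDl// esum_ge0.
  by rewrite -(leeD2lE _ _ SF) ltW.
have nF : \forall n \near \oo, forall x, F x -> a n x <= b x + dl%:E.
  apply: near_finite_set => // x _.
  have [bfin|] := boolP (b x \is a fin_num); last first.
    rewrite ge0_fin_numE// -leNgt leye_eq => /eqP bx.
    by exists 0%N => // n _ /=; rewrite bx addye// leey.
  have : limn_esup (a ^~ x) < b x + dl%:E.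
    by rewrite lte_spadder// lte_fin.
  by move=> /near_lt_limn_esup[N _ aN]; exists N => // n /aN /ltW.
near=> n.
have anF : forall x, F x -> a n x <= b x + dl%:E by near: n.
rewrite (esumID F)// !setTI.
have waF : \esum_(x in F) (w x * a n x) <=
    \esum_(x in setT) (w x * b x) + dl%:E * W.
  apply: (@le_trans _ _ (\esum_(x in F) (w x * b x + dl%:E * w x))).
    apply: le_esum => x Fx; rewrite (muleC _ (w x)) -ge0_muleDr//.
    by rewrite lee_pmul//; exact: anF.
  rewrite esumD//; last by move=> x _; rewrite mule_ge0.
  rewrite esumZl//; apply: leeD; first exact: esum_subset.
  by rewrite lee_pmul ?esum_ge0//; exact: esum_subset.
have waT : \esum_(x in ~` F) (w x * a n x) <= (e / 2)%:E.
  apply: le_trans tailF; apply: le_esum => x _.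
  by rewrite -[leRHS]mule1 lee_pmul.
apply: le_trans (leeD waF waT) _; rewrite -addeA leeD2l//.
rewrite -(fineK Wfin) -EFinM -EFinD lee_fin [leRHS]splitr lerD2r.
by rewrite /dl mulrAC ler_pdivrMr ?ltr_wpDl// ler_pM2l// lerDl.
Unshelve. all: by end_near. Qed.
End Esum.

(** * The Markov property for events of the past *)

Section CountableFibers.
Context {R : realType} {d : measure_display} {Omega : measurableType d}
  {T : countType} (H : Omega -> T).
Hypothesis mH : forall t, measurable [set w | H w = t].

Lemma measurable_countable_preimage (B : set T) : measurable (H @^-1` B).
Proof.
pose F n := if pickle_inv n is Some t then
  (if t \in B then [set w | H w = t] else set0) else set0.
rewrite (_ : _ @^-1` _ = \bigcup_n F n).
  by apply: bigcupT_measurable => n; rewrite /F; case: pickle_inv => // t;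
     case: ifP.
apply/seteqP; split=> [w /= BHw|w [n _]].
  by exists (pickle (H w)) => //; rewrite /F pickleK_inv mem_set.
by rewrite /F; case: pickle_inv => // t; case: ifP => // /set_mem Bt /= ->.
Qed.

(** Sigma-additivity along the values of a discrete random variable, indexed by
    the countable type itself rather than by an enumeration of it. *)
Lemma measure_countable_fibers (mu : probability Omega R)
    (A : set Omega) : measurable A ->
  mu A = (\esum_(t in setT) mu (A `&` [set w | H w = t]))%E.
Proof.
move=> mA; pose F n := if pickle_inv n is Some t
  then A `&` [set w | H w = t] else set0.
have mF n : measurable (F n).
  by rewrite /F; case: pickle_inv => // t; exact: measurableI.
have tF : trivIset setT F.
  move=> m n _ _ [w []]; rewrite /F.
  case Em: (pickle_inv m) => [t|//] [_ /= Hm].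
  case En: (pickle_inv n) => [t'|//] [_ /= Hn].
  have := pickle_invK (T := T) m; have := pickle_invK (T := T) n.
  by rewrite Em En /= -Hm -Hn => <- <-.
have AE : A = \bigcup_n F n.
  apply/seteqP; split=> [w Aw|w [n _]].
    by exists (pickle (H w)) => //; rewrite /F pickleK_inv.
  by rewrite /F; case: pickle_inv => // t [].
rewrite {1}AE measure_semi_bigcup//; last by rewrite -AE.
rewrite nneseries_esumT// (esumID (range (@pickle T)))// !setTI.
rewrite [X in (_ + X)%E]esum1 ?adde0; last first.
  move=> n nrange; rewrite /F; case Et: (pickle_inv n) => [t|]//; exfalso.
  by apply: nrange; exists t => //; have := pickle_invK (T := T) n; rewrite Et.
rewrite esum_image; last by move=> t t' _ _ /(pcan_inj pickleK_inv).
by apply: eq_esum => t _; rewrite /F pickleK_inv.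
Qed.

End CountableFibers.

Section Walk.
Context {R : realType} {X : countType} {d : measure_display}
  {Omega : measurableType d} (W : randomWalk R X Omega).
Local Open Scope ereal_scope.

(** The sigma-algebra generated by [Z_0, ..., Z_n]: as the state space is
    countable, measurability follows ([measurable_past]). *)
Definition past (n : nat) (E : set Omega) : Prop :=
  forall w w', (forall k, (k <= n)%N -> Z W k w = Z W k w') -> E w -> E w'.

Definition history (n : nat) (w : Omega) : seq X :=
  mkseq (fun k => Z W k w) n.+1.

Lemma eq_history n w w' :
  history n w = history n w' <-> forall k, (k <= n)%N -> Z W k w = Z W k w'.
Proof.
split=> [ww' k kn|ww'].
  have := congr1 (fun s => nth (Z W k w) s k) ww'.
  by rewrite !nth_mkseq.
by apply/eq_in_map => k; rewrite mem_iota add0n ltnS => /andP[_ /ww'].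
Qed.

Lemma measurable_history n s : measurable [set w | history n w = s].
Proof.
have [[w0 <-]|/forallNP nos] := pselect (exists w, history n w = s); last first.
  by rewrite (_ : [set _ | _] = set0)//; apply/seteqP; split => // w /nos.
rewrite (_ : [set _ | _] =
    \bigcap_k [set w | (k <= n)%N -> Z W k w = Z W k w0]).
  apply: bigcapT_measurable => k; case: (leqP k n) => kn.
    rewrite (_ : [set _ | _] = [set w | Z W k w = Z W k w0]).
      exact: measurable_Z.
    by apply/seteqP; split => w /=; [exact|].
  by rewrite (_ : [set _ | _] = setT)//; apply/seteqP; split.
apply/seteqP; split=> w /= => [/eq_history ww0 k _|ww0]; first exact: ww0.
by apply/eq_history => k; exact: ww0.
Qed.

Lemma measurable_past n E : past n E -> measurable E.
Proof.
move=> pE; rewrite (_ : E = history n @^-1` (history n @` E)).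
  by apply: measurable_countable_preimage => s; exact: measurable_history.
apply/seteqP; split=> [w Ew|w [w' Ew' /eq_history /pE]]; last exact.
by exists w.
Qed.

(** The Markov property conditionally on an arbitrary event of the past: on
    each trajectory of length [n] the event is either everything or nothing,
    and the identity for cylinders is summed over the trajectories. *)
Lemma markov_past x n E u v : past n E ->
  Pr W x (E `&` [set w | Z W n w = u] `&` [set w | Z W n.+1 w = v]) =
  Pr W x (E `&` [set w | Z W n w = u]) * (p W u v)%:E.
Proof.
move=> pE; have mE := measurable_past pE.
have mEu : measurable (E `&` [set w | Z W n w = u]).
  by apply: measurableI => //; exact: measurable_Z.
rewrite (measure_countable_fibers (measurable_history n)); last first.
  by apply: measurableI => //; exact: measurable_Z.
rewrite [in RHS](measure_countable_fibers (measurable_history n))// [RHS]muleC.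
rewrite -esumZl//; last by rewrite lee_fin p_ge0.
apply: eq_esum => s _; rewrite [RHS]muleC.
set Eu := E `&` _.
have [[w0 [[Ew0 w0u] w0s]]|/forallNP nos] :=
    pselect (exists w, (Eu `&` [set w | history n w = s]) w); last first.
  rewrite (_ : Eu `&` [set w | history n w = s] = set0); last first.
    by apply/seteqP; split=> // w /nos.
  rewrite (_ : Eu `&` _ `&` _ = set0) ?measure0 ?mul0e//.
  by apply/seteqP; split=> // w [[? _] ?]; apply: (nos w).
pose t k := if (k <= n)%N then Z W k w0 else v.
have tn k : (k <= n)%N -> t k = Z W k w0 by rewrite /t => ->.
rewrite (_ : Eu `&` [set w | history n w = s] =
    [set w | forall k, (k <= n)%N -> Z W k w = t k]); last first.
  apply/seteqP; split=> w /=; rewrite -w0s.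
    by move=> [_ /eq_history ww0] k kn; rewrite tn// ww0.
  move=> wt; have ww0 k : (k <= n)%N -> Z W k w = Z W k w0.
    by move=> kn; rewrite wt// tn.
  split; last exact/eq_history.
  split; last by rewrite /= ww0.
  by apply: (pE w0) => // k kn; rewrite ww0.
rewrite (_ : Eu `&` _ `&` _ =
    [set w | forall k, (k <= n.+1)%N -> Z W k w = t k]); last first.
  apply/seteqP; split=> w /=; rewrite -w0s.
    move=> [[_ wv] /eq_history ww0] k; rewrite leq_eqVlt => /predU1P[->|].
      by rewrite wv /t ltnn.
    by rewrite ltnS => kn; rewrite tn// ww0.
  move=> wt; have ww0 k : (k <= n)%N -> Z W k w = Z W k w0.
    by move=> kn; rewrite wt ?tn// ltnW.
  split; last exact/eq_history.
  split; last by rewrite wt// /t ltnn.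
  split; last by rewrite /= ww0.
  by apply: (pE w0) => // k kn; rewrite ww0.
have tS : t n.+1 = v by rewrite /t ltnn.
by rewrite Defs.markov tn// tS w0u.
Qed.

(** * Walks confined to a set *)

(** Time [0] is left free, so that with [A] the complement of [{y}] a walk
    started at [y] stays in [A] exactly as long as it has not returned. *)
Definition stays (A : set X) (n : nat) : set Omega :=
  [set w | forall k, (1 <= k <= n)%N -> A (Z W k w)].

(** Taboo probabilities.  Both [pn] (with [A] the whole space) and the
    excursions from a state (with [A] its complement) are instances. *)
Definition pn_in (A : set X) (n : nat) (x z : X) : \bar R :=
  Pr W x (stays A n `&` [set w | Z W n w = z]).

Definition stay_prob (A : set X) (n : nat) (x : X) : \bar R :=
  Pr W x (stays A n).

Lemma past_stays A n : past n (stays A n).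
Proof.
by move=> w w' ww' Aw k /andP[k0 kn]; rewrite -ww'//; apply: Aw; rewrite k0 kn.
Qed.

Lemma measurable_stays A n : measurable (stays A n).
Proof. exact: measurable_past (@past_stays A n). Qed.

Lemma measurable_stays_at A n z :
  measurable (stays A n `&` [set w | Z W n w = z]).
Proof.
by apply: measurableI; [exact: measurable_stays|exact: measurable_Z].
Qed.
Hint Resolve measurable_stays measurable_stays_at : core.

Lemma pn_inT n x z : pn_in setT n x z = pn W n x z.
Proof.
by rewrite /pn_in /pn (_ : stays setT n = setT) ?setTI//; apply/seteqP; split.
Qed.

Lemma pn_in_ge0 A n x z : 0 <= pn_in A n x z.
Proof. exact: measure_ge0. Qed.

Lemma pn_in_le1 A n x z : pn_in A n x z <= 1.
Proof. exact: probability_le1. Qed.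

Lemma pn_in_fin A n x z : pn_in A n x z \is a fin_num.
Proof. exact: fin_num_measure. Qed.

Lemma stay_prob_ge0 A n x : 0 <= stay_prob A n x.
Proof. exact: measure_ge0. Qed.

Lemma stay_prob_le1 A n x : stay_prob A n x <= 1.
Proof. exact: probability_le1. Qed.
Hint Resolve pn_in_ge0 stay_prob_ge0 : core.

Lemma pE_ge0 x y : 0 <= (p W x y)%:E.
Proof. by rewrite lee_fin p_ge0. Qed.
Hint Resolve pE_ge0 : core.

Lemma pn_in0 A x : pn_in A 0 x x = 1.
Proof.
rewrite /pn_in (_ : stays A 0 = setT) ?setTI ?start//.
by apply/seteqP; split=> // w _ [|k].
Qed.

Lemma pn_in0_neq A x z : z != x -> pn_in A 0 x z = 0.
Proof.
move=> zx; apply/eqP; rewrite eq_le measure_ge0 andbT.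
have mx : measurable [set w | Z W 0 w = x] by exact: measurable_Z.
have <- : Pr W x (~` [set w | Z W 0 w = x]) = 0.
  by rewrite probability_setC// start subee.
apply: le_measure; rewrite ?inE//; first exact: measurableC.
by move=> w [_ /= -> /eqP]; apply/negP.
Qed.

Lemma pn_inS A n x z : A z ->
  pn_in A n.+1 x z = \esum_(u in setT) (pn_in A n x u * (p W u z)%:E).
Proof.
move=> Az; rewrite /pn_in.
have -> : stays A n.+1 `&` [set w | Z W n.+1 w = z] =
    stays A n `&` [set w | Z W n.+1 w = z].
  apply/seteqP; split=> w /= [Aw wz]; split=> // k.
    by move=> /andP[k0 kn]; apply: Aw; rewrite k0 (leq_trans kn).
  rewrite [(k <= n.+1)%N]leq_eqVlt ltnS.
  move=> /andP[k0 /predU1P[->|kn]]; first by rewrite wz.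
  by apply: Aw; rewrite k0.
rewrite (measure_countable_fibers (measurable_Z W n)); last first.
  by apply: measurableI => //; exact: measurable_Z.
by apply: eq_esum => u _; rewrite setIAC markov_past//; exact: past_stays.
Qed.

Lemma pn_inS_out A n x z : ~ A z -> pn_in A n.+1 x z = 0.
Proof.
move=> nAz; rewrite /pn_in (_ : _ `&` _ = set0) ?measure0//.
apply/seteqP; split=> // w [/= Aw wz]; apply: nAz; rewrite -wz; apply: Aw.
by rewrite leqnn.
Qed.

Lemma pn_inD A m n x z :
  pn_in A (m + n) x z = \esum_(u in setT) (pn_in A m x u * pn_in A n u z).
Proof.
elim: n z => [|n IHn] z.
  rewrite addn0 (@esum_single _ _ _ z) ?pn_in0 ?mule1// => u uz.
  by rewrite pn_in0_neq ?mule0// eq_sym.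
have [Az|nAz] := pselect (A z); last first.
  rewrite addnS pn_inS_out// esum1// => u _.
  by rewrite pn_inS_out ?mule0.
rewrite addnS pn_inS//.
transitivity (\esum_(u in setT) \esum_(v in setT)
    ((p W u z)%:E * (pn_in A m x v * pn_in A n v u))).
  apply: eq_esum => u _; rewrite IHn muleC esumZl// => v.
  by rewrite mule_ge0.
rewrite esum_exchange; last by move=> *; rewrite !mule_ge0.
apply: eq_esum => v _; rewrite pn_inS// -esumZl//; last first.
  by move=> u; rewrite mule_ge0.
by apply: eq_esum => u _; rewrite muleC muleA.
Qed.

Lemma stay_probE A n x : stay_prob A n x = \esum_(z in setT) pn_in A n x z.
Proof. by rewrite /stay_prob (measure_countable_fibers (measurable_Z W n)). Qed.

Lemma stay_probD A m n x :
  stay_prob A (m + n) x = \esum_(u in setT) (pn_in A m x u * stay_prob A n u).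
Proof.
rewrite stay_probE.
under eq_esum => z _ do rewrite pn_inD.
rewrite esum_exchange; last by move=> *; rewrite mule_ge0.
by apply: eq_esum => u _; rewrite esumZl// stay_probE.
Qed.

Lemma stay_prob0 A x : stay_prob A 0 x = 1.
Proof.
rewrite stay_probE (@esum_single _ _ _ x) ?pn_in0// => z.
exact: pn_in0_neq.
Qed.

Lemma pn_in1 A x z : A z -> pn_in A 1 x z = (p W x z)%:E.
Proof.
move=> Az; rewrite pn_inS// (@esum_single _ _ _ x); last 2 first.
- by rewrite mule_ge0.
- by move=> u ux; rewrite pn_in0_neq ?mul0e.
by rewrite pn_in0 mul1e.
Qed.

Lemma stay_probS A n x :
  stay_prob A n.+1 x = \esum_(u in A) ((p W x u)%:E * stay_prob A n u).
Proof.
rewrite -add1n stay_probD [RHS]esum_mkcond; apply: eq_esum => u _.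
case: ifPn => [/set_mem Au|/negP nAu]; first by rewrite pn_in1.
by rewrite pn_inS_out ?mul0e// => Au; apply: nAu; rewrite mem_set.
Qed.

End Walk.

(** * Return times *)

Section ReturnTime.
Context {R : realType} {X : countType} {d : measure_display}
  {Omega : measurableType d} (W : randomWalk R X Omega).
Local Open Scope ereal_scope.
Let pn_in_nneg A n x y : 0 <= pn_in W A n x y := pn_in_ge0 W A n x y.
Let stay0 A n x : 0 <= stay_prob W A n x := stay_prob_ge0 W A n x.
Let p0 x y : 0 <= (p W x y)%:E := pE_ge0 W x y.
Hint Resolve pn_in_nneg stay0 p0 : core.

Definition miss_prob (y : X) (n : nat) (x : X) : \bar R :=
  stay_prob W (~` [set y]) n x.

Definition mean_return (y : X) : \bar R :=
  \int[Pr W y]_w return_time W y w.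

(** [T_y] counts the times [n >= 0] such that no return has happened up to
    [n]. *)
Lemma return_timeE y w :
  return_time W y w = \sum_(n <oo) (\1_(stays W (~` [set y]) n) w)%:E.
Proof.
have [ret|noret] :=
  pselect (exists n, (1 <= n)%N && (Z W n w == y)); last first.
  rewrite /return_time (_ : [set _ | _ in _] = set0).
    rewrite ereal_inf0; apply/esym/eq_infty => r.
    apply: (@le_trans _ _ (\sum_(0 <= k < (Num.truncn `|r|%R).+1)
        (\1_(stays W (~` [set y]) k) w : R)%:E)); last first.
      by apply: nneseries_lim_ge => n _ _; rewrite lee_fin indicE.
    rewrite (eq_bigr (fun=> 1%:E)).
      rewrite big_nat sumEFin lee_fin -big_nat big_const_nat subn0.
      rewrite iter_addr addr0.
      by rewrite ltW// (le_lt_trans (ler_norm _))// truncnS_gt.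
    move=> k _; rewrite indicE mem_set// => j /andP[j1 _] Zj.
    by apply: noret; exists j; rewrite j1; apply/eqP.
  apply/seteqP; split=> // t [n [n1 Zn] _]; apply: noret; exists n.
  by rewrite n1; apply/eqP.
have [N /andP[N1 /eqP ZN] Nmin] := ex_minnP ret.
have staysN k : (k < N)%N -> stays W (~` [set y]) k w.
  move=> kN j /andP[j1 jk] Zj.
  have : (N <= j)%N by apply: Nmin; rewrite j1; apply/eqP.
  by rewrite leqNgt (leq_ltn_trans jk kN).
have nstaysN k : (N <= k)%N -> ~ stays W (~` [set y]) k w.
  by move=> Nk /(_ N); rewrite N1 Nk => /(_ isT).
transitivity (N%:R%:E : \bar R).
  apply/eqP; rewrite eq_le; apply/andP; split.
    by apply: ereal_inf_lbound; exists N.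
  apply: le_ereal_inf_tmp => _ [n [n1 Zn] <-]; rewrite lee_fin ler_nat.
  by apply: Nmin; rewrite n1; apply/eqP.
rewrite (nneseries_split 0 N); last by move=> k _; rewrite lee_fin indicE.
rewrite add0n (eq_big_nat _ _ (F2 := fun=> 1%:E)); last first.
  by move=> k /andP[_ kN]; rewrite indicE mem_set//; exact: staysN.
rewrite [X in _ + X]eseries0 ?adde0; last first.
  by move=> k Nk _; rewrite indicE memNset//; exact: nstaysN.
by rewrite sumEFin big_const_nat subn0 iter_addr addr0.
Qed.

Lemma mean_returnE y : mean_return y = \sum_(n <oo) miss_prob y n y.
Proof.
rewrite /mean_return; under eq_integral do rewrite return_timeE.
rewrite integral_nneseries//.
- apply: eq_eseriesr => n _; rewrite integral_indic ?setIT//.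
  exact: measurable_stays.
- move=> n; apply/measurable_realfun.measurable_EFinP.
  apply: measurable_realfun.measurable_indic; exact: measurable_stays.
Qed.

Lemma mean_return_ge1 y : 1 <= mean_return y.
Proof.
rewrite mean_returnE -(stay_prob0 W (~` [set y]) y).
apply: le_trans (nneseries_lim_ge 1 _); last by [].
by rewrite big_nat1.
Qed.

Lemma stay_prob_noninc A m n x :
  (m <= n)%N -> stay_prob W A n x <= stay_prob W A m x.
Proof.
move=> mn; apply: le_measure; rewrite ?inE; try exact: measurable_stays.
by move=> w Aw k /andP[k1 km]; apply: Aw; rewrite k1 (leq_trans km).
Qed.

(** A nonincreasing sequence with finite sum [m] satisfies [n f_n <= m]. *)
Lemma limn_esup_miss_prob_start y :
  mean_return y < +oo -> limn_esup (fun n => miss_prob y n y) <= 0.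
Proof.
move=> moo; have m1 := mean_return_ge1 y.
have mfin : mean_return y \is a fin_num.
  by rewrite ge0_fin_numE// (le_trans _ m1).
apply/lee_addgt0Pr => e e0; rewrite add0e; apply: limn_esup_le_near.
exists (Num.truncn (fine (mean_return y) / e)).+1 => // n /= n_big.
have n0 : (0 < n%:R :> R)%R by rewrite ltr0n (leq_trans _ n_big).
have nf : n%:R%:E * miss_prob y n y <= mean_return y.
  rewrite mean_returnE; apply: le_trans (nneseries_lim_ge n _); last by [].
  rewrite (_ : n%:R%:E * _ = \sum_(0 <= k < n) miss_prob y n y).
    rewrite big_nat [leRHS]big_nat; apply: lee_sum => k /andP[_ kn].
    by apply: stay_prob_noninc; exact: ltnW.
  by rewrite sumr_const_nat subn0 mule_natl.
rewrite -(@lee_pmul2l _ n%:R%:E)// (le_trans nf)// -(fineK mfin) -EFinM lee_fin.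
by rewrite -ler_pdivrMr// ltW// (lt_le_trans (truncnS_gt _))// ler_nat.
Qed.

Lemma return_event_compl y :
  [set w | exists n, (1 <= n)%N /\ Z W n w = y] =
  ~` (\bigcap_n stays W (~` [set y]) n).
Proof.
apply/seteqP; split=> w /=.
  by move=> [n [n1 Zn]] /(_ n I n) /=; rewrite n1 leqnn => /(_ isT).
move=> nst; apply: contrapT => noret; apply: nst => n _ k /andP[k1 _] Zk.
by apply: noret; exists k.
Qed.

(** Never returning is contained in every event of not having returned before
    time [n], and these have vanishing probability. *)
Lemma recurrent_of_mean_return y : mean_return y < +oo ->
  Pr W y [set w | exists n, (1 <= n)%N /\ Z W n w = y] = 1.
Proof.
move=> /limn_esup_miss_prob_start f0.
have mI : measurable (\bigcap_n stays W (~` [set y]) n).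
  by apply: bigcapT_measurable => n; exact: measurable_stays.
rewrite return_event_compl probability_setC// [X in _ - X](_ : _ = 0) ?sube0//.
apply/eqP; rewrite eq_le measure_ge0 andbT; apply: le_trans f0.
apply: limn_esup_ge_frequently => N; exists N => //.
apply: le_measure; rewrite ?inE//; first exact: measurable_stays.
exact: bigcap_inf.
Qed.

Lemma positive_recurrentE :
  positive_recurrent W <-> forall y, mean_return y < +oo.
Proof.
split=> [[]//|m]; split=> // y; exact: recurrent_of_mean_return.
Qed.

Lemma pn_inS_gt0 A n x y : 0 < pn_in W A n.+1 x y ->
  exists2 u, 0 < pn_in W A n x u & 0 < (p W u y)%:E.
Proof.
have [Ay|nAy] := pselect (A y); last by rewrite pn_inS_out ?ltxx.
rewrite pn_inS// => sum_gt0.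
have [u pu] : exists u, 0 < pn_in W A n x u * (p W u y)%:E.
  apply: contrapT => /forallNP nou; move: sum_gt0; rewrite esum1 ?ltxx// => u _.
  have /negP := nou u; rewrite -leNgt => pu0.
  by apply: ge0_le0_eq0 pu0; rewrite mule_ge0.
exists u.
- rewrite lt0e pn_in_ge0 andbT.
  by apply: contraTneq pu => ->; rewrite mul0e ltxx.
- rewrite lt0e pE_ge0 andbT.
  by apply: contraTneq pu => ->; rewrite mule0 ltxx.
Qed.

(** Keep only the part of a path from [x] to [y] after its last visit to
    [x]. *)
Lemma pn_in_gt0_of_pn x y n : 0 < pn W n x y ->
  exists m, 0 < pn_in W (~` [set x]) m x y.
Proof.
elim: n y => [|n IHn] y.
  rewrite -pn_inT => pxy; exists 0%N; have [->|yx] := eqVneq y x.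
    by rewrite pn_in0.
  by move: pxy; rewrite pn_in0_neq ?ltxx.
rewrite -pn_inT => /pn_inS_gt0[u pu0 puy].
have [->|/eqP yx] := eqVneq y x; first by exists 0%N; rewrite pn_in0.
rewrite pn_inT in pu0; have [m pm] := IHn _ pu0.
exists m.+1; rewrite pn_inS//; apply: lt_le_trans (mule_gt0 pm puy) _.
apply: (@esum_ge_term _ _ _ (fun u => _ u * (p W u y)%:E)) => // z _.
by rewrite mule_ge0.
Qed.

(** From [y] the walk can go to [x] without returning to [y], with some
    probability [c > 0] in [m] steps; missing [y] for [n] further steps then
    makes it miss [y] for [m + n] steps from the start. *)
Lemma limn_esup_miss_prob x y : irreducible W -> mean_return y < +oo ->
  limn_esup (fun n => miss_prob y n x) <= 0.
Proof.
move=> irr moo; have [n pn0] := irr y x; have [m c0] := pn_in_gt0_of_pn pn0.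
set c := pn_in _ _ _ _ _ in c0.
have cfin : c \is a fin_num by exact: pn_in_fin.
apply/lee_addgt0Pr => e e0; rewrite add0e; apply: limn_esup_le_near.
have /near_lt_limn_esup[N _ fN] :
    limn_esup (fun n => miss_prob y n y) < c * e%:E.
  apply: le_lt_trans (limn_esup_miss_prob_start moo) _.
  by rewrite mule_gt0// lte_fin.
exists N => // k /= Nk; rewrite -(@lee_pmul2l _ c)// ltW//.
apply: le_lt_trans (fN (m + k)%N _); last first.
  by rewrite /= (leq_trans Nk)// leq_addl.
rewrite /miss_prob stay_probD.
apply: (@esum_ge_term _ _ _ (fun u => _ u * stay_prob W _ k u)) => // z _.
by rewrite mule_ge0.
Qed.

End ReturnTime.

(** * Stationary measures *)

Section Stationary.
Context {R : realType} {X : countType} {d : measure_display}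
  {Omega : measurableType d} (W : randomWalk R X Omega).
Local Open Scope ereal_scope.
Implicit Types (t : X -> \bar R) (nu : X -> R).

Let pn_in_nneg A n x y : 0 <= pn_in W A n x y := pn_in_ge0 W A n x y.
Let stay0 A n x : 0 <= stay_prob W A n x := stay_prob_ge0 W A n x.
Let p0 x y : 0 <= (p W x y)%:E := pE_ge0 W x y.
Hint Resolve pn_in_nneg stay0 p0 : core.

Definition push t (y : X) : \bar R := \esum_(x in setT) (t x * (p W x y)%:E).

Definition invariant_measure t : Prop := forall y, push t y = t y.

Lemma push_ge0 t y : (forall x, 0 <= t x) -> 0 <= push t y.
Proof. by move=> t0; apply: esum_ge0 => x _; rewrite mule_ge0. Qed.

Lemma esum_push t : (forall x, 0 <= t x) ->
  \esum_(y in setT) push t y = \esum_(x in setT) t x.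
Proof.
move=> t0; rewrite /push esum_exchange; last by move=> *; rewrite mule_ge0.
by apply: eq_esum => x _; rewrite esumZl// p_sum1 mule1.
Qed.

Lemma invariant_of_le t : (forall x, 0 <= t x) -> \esum_(x in setT) t x < +oo ->
  (forall y, t y <= push t y) -> invariant_measure t.
Proof.
move=> t0 too le y; apply/esym/(@eq_of_le_esum_eq _ _ t) => //.
by rewrite esum_push.
Qed.

Lemma invariant_of_ge t : (forall x, 0 <= t x) -> \esum_(x in setT) t x < +oo ->
  (forall y, push t y <= t y) -> invariant_measure t.
Proof.
move=> t0 too le y; apply: (@eq_of_le_esum_eq _ _ (push t)) => //.
- by move=> x; exact: push_ge0.
- by rewrite esum_push.
- by rewrite esum_push.
Qed.

Lemma invariant_pn t n y : (forall x, 0 <= t x) -> invariant_measure t ->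
  \esum_(x in setT) (t x * pn W n x y) = t y.
Proof.
move=> t0 ti; elim: n y => [|n IHn] y.
  rewrite (@esum_single _ _ _ y) -?pn_inT ?pn_in0 ?mule1// => x xy.
  by rewrite -pn_inT pn_in0_neq ?mule0// eq_sym.
rewrite -[RHS]ti /push -[in RHS](funext IHn).
transitivity (\esum_(x in setT) \esum_(z in setT)
    ((p W z y)%:E * (t x * pn_in W setT n x z))).
  apply: eq_esum => x _; rewrite -pn_inT pn_inS// -esumZl//; last first.
    by move=> u; rewrite mule_ge0.
  by apply: eq_esum => z _; rewrite muleC muleAC muleC (muleC (t x)).
rewrite esum_exchange; last by move=> *; rewrite !mule_ge0.
apply: eq_esum => z _; rewrite esumZl//; last by move=> u; rewrite mule_ge0.
by rewrite muleC; congr (_ * _); apply: eq_esum => u _; rewrite pn_inT.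
Qed.

Lemma invariant_gt0 t x y : irreducible W -> (forall x, 0 <= t x) ->
  invariant_measure t -> 0 < t x -> 0 < t y.
Proof.
move=> irr t0 ti tx; have [n pn0] := irr x y.
rewrite -(invariant_pn n y t0 ti); apply: lt_le_trans (mule_gt0 tx pn0) _.
apply: (@esum_ge_term _ _ _ (fun x => t x * pn W n x y)) => // z _.
by rewrite mule_ge0// -pn_inT.
Qed.

(** Under the law started from [t], the walk is distributed as [t] at every
    time.  The [k]-th summand is the mass of the paths whose last visit to [y]
    up to time [n] takes place at time [n - k]; the remaining sum is the mass
    of those that miss [y] at times [1, ..., n], and the paths counted by it
    may start at [y], which accounts for the range [k < n]. *)
Lemma invariant_last_visit t n y :
  (forall x, 0 <= t x) -> invariant_measure t ->
  t y * \sum_(0 <= k < n) miss_prob W y k y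
    + \esum_(x in setT) (t x * miss_prob W y n x) = \esum_(x in setT) t x.
Proof.
move=> t0 ti; elim: n => [|n IHn].
  rewrite big_geq// mule0 add0e; apply: eq_esum => x _.
  by rewrite /miss_prob stay_prob0 mule1.
rewrite -[RHS]IHn big_nat_recr//= ge0_muleDr//; last exact: sume_ge0.
rewrite -addeA; congr (_ + _).
rewrite (esum_split y (a := fun x => t x * miss_prob W y n x)); last first.
  by move=> x; rewrite mule_ge0.
congr (_ + _).
transitivity (\esum_(x in setT) \esum_(u in ~` [set y])
    (miss_prob W y n u * (t x * (p W x u)%:E))).
  apply: eq_esum => x _; rewrite {1}/miss_prob stay_probS -esumZl//.
    by apply: eq_esum => u _; rewrite muleA muleC.
  by move=> u; rewrite mule_ge0.
rewrite esum_exchange; last by move=> *; rewrite !mule_ge0.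
apply: eq_esum => u _; rewrite esumZl//; last by move=> x; rewrite mule_ge0.
by rewrite -[\esum_(_ in _) _]/(push t u) ti muleC.
Qed.

(** This inequality does not presuppose a finite mean return time, and is what
    makes it finite. *)
Lemma invariant_mean_return_le t y :
  (forall x, 0 <= t x) -> invariant_measure t ->
  \esum_(x in setT) t x < +oo ->
  t y * mean_return W y <= \esum_(x in setT) t x.
Proof.
move=> t0 ti too.
have tyfin : t y \is a fin_num.
  by rewrite ge0_fin_numE// (le_lt_trans _ too)//; exact: esum_ge_term.
rewrite mean_returnE -(fineK tyfin) -nneseriesZl//; apply: lime_le.
  by apply: is_cvg_nneseries => n _ _; rewrite fineK// mule_ge0.
apply: nearW => n; rewrite fineK// -ge0_sume_distrr//.
rewrite -(invariant_last_visit n y t0 ti) leeDl// esum_ge0// => x _.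
by rewrite mule_ge0.
Qed.

(** Kac's formula: the last-visit identity in the limit, where the mass of the
    paths that miss [y] vanishes by dominated convergence. *)
Lemma invariant_mean_return t y : irreducible W -> mean_return W y < +oo ->
  (forall x, 0 <= t x) -> invariant_measure t -> \esum_(x in setT) t x < +oo ->
  t y * mean_return W y = \esum_(x in setT) t x.
Proof.
move=> irr moo t0 ti too; apply/eqP; rewrite eq_le invariant_mean_return_le//=.
apply/lee_addgt0Pr => e e0.
have : limn_esup (fun n => \esum_(x in setT) (t x * miss_prob W y n x)) < e%:E.
  apply: (@le_lt_trans _ _ (\esum_(x in setT) (t x * 0))).
    apply: limn_esup_esum_le => // [n x|x].
      by rewrite stay0 stay_prob_le1.
    exact: limn_esup_miss_prob.
  by rewrite esum1 ?lte_fin// => x _; rewrite mule0.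
move=> /near_lt_limn_esup[N _ /(_ N (leqnn N)) /= small].
rewrite -(invariant_last_visit N y t0 ti); apply: leeD; last exact: ltW.
by rewrite lee_pmul// ?sume_ge0// mean_returnE nneseries_lim_ge.
Qed.

(** The expected number of visits to [z] during an excursion from [y0]. *)
Definition occupation (y0 z : X) : \bar R :=
  \esum_(k in [set: nat]) pn_in W (~` [set y0]) k y0 z.

Lemma occupation_ge0 y0 z : 0 <= occupation y0 z.
Proof. by apply: esum_ge0. Qed.
Hint Resolve occupation_ge0 : core.

Lemma esum_occupation y0 :
  \esum_(z in setT) occupation y0 z = mean_return W y0.
Proof.
rewrite mean_returnE nneseries_esumT// esum_exchange//.
by apply: eq_esum => k _; rewrite -stay_probE.
Qed.

Lemma push_occupation y0 z :
  z != y0 -> push (occupation y0) z = occupation y0 z.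
Proof.
move=> zy0; rewrite /push /occupation.
rewrite (esum_split 0%N (a := fun k => pn_in W _ k y0 z))//.
rewrite pn_in0_neq// add0e.
have bij : set_bij [set: nat] (~` [set 0%N]) S.
  by split=> [k _ /= //|k l _ _ [] //|[|k] //= _]; exists k.
rewrite (@reindex_esum _ _ _ _ _ _ _ bij).
transitivity (\esum_(x in setT) \esum_(k in [set: nat])
   ((p W x z)%:E * pn_in W (~` [set y0]) k y0 x)).
  by apply: eq_esum => x _; rewrite esumZl// muleC.
rewrite esum_exchange; last by move=> *; rewrite mule_ge0.
apply: eq_esum => k _; rewrite pn_inS; last exact/eqP.
by apply: eq_esum => x _; rewrite muleC.
Qed.

(** Shifting time shows invariance away from [y0].  At [y0] the occupation
    measure and its image are comparable one way or the other, and either way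
    they agree, having the same finite mass. *)
Lemma invariant_occupation y0 :
  mean_return W y0 < +oo -> invariant_measure (occupation y0).
Proof.
move=> moo; have too : \esum_(z in setT) occupation y0 z < +oo.
  by rewrite esum_occupation.
have [le|/ltW le] := leP (occupation y0 y0) (push (occupation y0) y0).
  apply: invariant_of_le => // y; have [->//|yy0] := eqVneq y y0.
  by rewrite push_occupation.
apply: invariant_of_ge => // y; have [->//|yy0] := eqVneq y y0.
by rewrite push_occupation.
Qed.

(** * Signed measures *)

Lemma ssum_ge0 (f : X -> R) : (forall x, (0 <= f x)%R) ->
  ssum f = \esum_(x in setT) (f x)%:E.
Proof.
move=> f0; rewrite /ssum [X in _ - X]esum1 ?sube0; last first.
  by move=> x _; rewrite funenegE max_r//= lee_fin oppr_le0.
by apply: eq_esum => x _; rewrite funeposE /= max_l// lee_fin.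
Qed.

Lemma stationary_of_invariant t : (forall x, 0 <= t x) ->
  \esum_(x in setT) t x < +oo -> invariant_measure t ->
  finite_variation (fine \o t) /\ stationary W (fine \o t).
Proof.
move=> t0 too ti.
have tfin x : t x \is a fin_num.
  by rewrite ge0_fin_numE// (le_lt_trans _ too)//; exact: esum_ge_term.
split.
  rewrite /finite_variation /summable (eq_esum (b := t))// => x _.
  by rewrite gee0_abs /= ?fineK.
move=> y; rewrite ssum_ge0; last by move=> x; rewrite mulr_ge0 ?p_ge0 ?fine_ge0.
rewrite /= fineK// -[RHS]ti; apply: eq_esum => x _.
by rewrite EFinM fineK// muleC.
Qed.

Definition pos_part nu : X -> \bar R := (EFin \o nu)^\+.
Definition neg_part nu : X -> \bar R := (EFin \o nu)^\-.

(** The image of [nu] is at most the image of its positive part, so the latter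
    can only gain mass at every state; since its total mass is preserved, it
    gains none.  Likewise for the negative part. *)
Lemma stationary_parts nu : finite_variation nu -> stationary W nu ->
  [/\ invariant_measure (pos_part nu), \esum_(x in setT) pos_part nu x < +oo,
      invariant_measure (neg_part nu) & \esum_(x in setT) neg_part nu x < +oo].
Proof.
move=> fv st.
have poo : \esum_(x in setT) pos_part nu x < +oo.
  have := summable_funepos fv; apply: le_lt_trans; apply: le_esum => x _.
  exact: lee_abs.
have noo : \esum_(x in setT) neg_part nu x < +oo.
  have := summable_funeneg fv; apply: le_lt_trans; apply: le_esum => x _.
  exact: lee_abs.
have pos0 x : 0 <= pos_part nu x by exact: funepos_ge0.
have neg0 x : 0 <= neg_part nu x by exact: funeneg_ge0.
have push_diff y : push (pos_part nu) y - push (neg_part nu) y = (nu y)%:E.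
  rewrite -st /ssum; congr (_ - _); apply: eq_esum => x _.
    rewrite /pos_part !funeposE /= -!EFin_max -EFinM; congr EFin.
    by rewrite -{2}(mulr0 (p W x y)) -maxr_pMr ?p_ge0// mulrC.
  rewrite /neg_part !funenegE /= -!EFin_max -EFinM; congr EFin.
  by rewrite -mulrN -{2}(mulr0 (p W x y)) -maxr_pMr ?p_ge0// mulrC.
have push_fin t y : (forall x, 0 <= t x) -> \esum_(x in setT) t x < +oo ->
    push t y \is a fin_num.
  move=> t0 too; rewrite ge0_fin_numE ?push_ge0//; apply: le_lt_trans too.
  rewrite -esum_push//; apply: esum_ge_term => // z _; exact: push_ge0.
split=> //; apply: invariant_of_le => // y.
  rewrite {1}/pos_part funeposE ge_max push_ge0// andbT /= -push_diff.
  by rewrite leeBlDr ?push_fin// leeDl// push_ge0.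
rewrite {1}/neg_part funenegE ge_max push_ge0// andbT /= EFinN -push_diff.
rewrite fin_num_oppeB ?push_fin// addeC leeBlDr ?push_fin//.
by rewrite leeDl// push_ge0.
Qed.

End Stationary.

(** * The measure given by mean return times *)

Section KacMeasure.
Context {R : realType} {X : countType} {d : measure_display}
  {Omega : measurableType d} (W : randomWalk R X Omega).
Hypothesis irr : irreducible W.
Local Open Scope ereal_scope.

Let p0 x y : 0 <= (p W x y)%:E := pE_ge0 W x y.
Hint Resolve p0 : core.

Lemma mean_return_finite_of_stationary nu : finite_variation nu ->
  stationary W nu -> (exists x, nu x != 0%R) -> forall y, mean_return W y < +oo.
Proof.
move=> fv st [x nux] y; have [pi poo ni noo] := stationary_parts fv st.
have finite_of t : (forall x, 0 <= t x) -> invariant_measure W t ->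
    \esum_(x in setT) t x < +oo -> 0 < t x -> mean_return W y < +oo.
  move=> t0 ti too tx; have ty := invariant_gt0 y irr t0 ti tx.
  rewrite ltNge leye_eq; apply/negP => /eqP moo.
  have := invariant_mean_return_le y t0 ti too.
  by rewrite moo gt0_muley// leye_eq => /eqP tE; rewrite tE ltxx in too.
have [nu0|nu0|nu0] := ltgtP (nu x) 0%R.
- apply: (finite_of (neg_part nu)) => //; first by move=> z; exact: funeneg_ge0.
  by rewrite /neg_part funenegE lt_max /= lte_fin oppr_gt0 nu0.
- apply: (finite_of (pos_part nu)) => //; first by move=> z; exact: funepos_ge0.
  by rewrite /pos_part funeposE lt_max /= lte_fin nu0.
- by rewrite nu0 eqxx in nux.
Qed.

Hypothesis mean_finite : forall y, mean_return W y < +oo.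

Definition kac_measure (y : X) : R := (fine (mean_return W y))^-1.

Lemma mean_return_fin y : mean_return W y \is a fin_num.
Proof. by rewrite ge0_fin_numE// (le_trans _ (mean_return_ge1 W y)). Qed.

Lemma fine_mean_return_gt0 y : (0 < fine (mean_return W y))%R.
Proof.
by rewrite fine_gt0// mean_finite (lt_le_trans _ (mean_return_ge1 W y)).
Qed.

Lemma kac_measure_gt0 y : (0 < kac_measure y)%R.
Proof. by rewrite invr_gt0 fine_mean_return_gt0. Qed.

Lemma invariant_kac t y : (forall x, 0 <= t x) -> invariant_measure W t ->
  \esum_(x in setT) t x < +oo ->
  t y = (\esum_(x in setT) t x) * (kac_measure y)%:E.
Proof.
move=> t0 ti too.
rewrite -(invariant_mean_return irr (mean_finite y) t0 ti too).
rewrite -(fineK (mean_return_fin y)) -muleA -EFinM mulfV ?mule1//.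
by rewrite gt_eqF// fine_mean_return_gt0.
Qed.

Lemma stationary_kac nu : finite_variation nu -> stationary W nu ->
  exists alpha : R, forall y, nu y = (alpha * kac_measure y)%R.
Proof.
move=> fv st; have [pi poo ni noo] := stationary_parts fv st.
have pos0 x : 0 <= pos_part nu x by exact: funepos_ge0.
have neg0 x : 0 <= neg_part nu x by exact: funeneg_ge0.
set P := \esum_(x in setT) pos_part nu x in poo.
set N := \esum_(x in setT) neg_part nu x in noo.
have Pfin : P \is a fin_num by rewrite ge0_fin_numE// esum_ge0.
have Nfin : N \is a fin_num by rewrite ge0_fin_numE// esum_ge0.
exists (fine P - fine N)%R => y; apply: EFin_inj.
have -> : (nu y)%:E = pos_part nu y - neg_part nu y.
  by rewrite -[LHS]/((EFin \o nu) y) {1}[EFin \o nu]funeposneg.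
rewrite (invariant_kac y pos0)// (invariant_kac y neg0)// -/P -/N.
by rewrite -{1}(fineK Pfin) -{1}(fineK Nfin) mulrBl.
Qed.

Lemma push_scale (c : R) t y : (0 <= c)%R -> (forall x, 0 <= t x) ->
  push W (fun x => c%:E * t x) y = c%:E * push W t y.
Proof.
move=> c0 t0; rewrite /push -esumZl//; last by move=> x; rewrite mule_ge0.
by apply: eq_esum => x _; rewrite muleA.
Qed.

(** This transfers invariance and total mass from the occupation measure. *)
Lemma kac_occupation y0 y :
  (kac_measure y)%:E = (kac_measure y0)%:E * occupation W y0 y.
Proof.
rewrite (invariant_kac (t := occupation W y0) y)//.
- rewrite esum_occupation muleA -(fineK (mean_return_fin y0)) -!EFinM.
  rewrite mulVf ?mul1r//.
  by rewrite gt_eqF// fine_mean_return_gt0.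
- by move=> x; exact: occupation_ge0.
- exact: invariant_occupation.
- by rewrite esum_occupation.
Qed.

Lemma invariant_kac_measure (y0 : X) :
  invariant_measure W (EFin \o kac_measure).
Proof.
rewrite (_ : _ \o _ =
    fun y => (kac_measure y0)%:E * occupation W y0 y); last first.
  by apply/funext => y; rewrite /= (kac_occupation y0).
move=> y; rewrite push_scale ?invariant_occupation//.
- by rewrite ltW// kac_measure_gt0.
- by move=> x; exact: occupation_ge0.
Qed.

Lemma esum_kac_measure (y0 : X) : \esum_(y in setT) (kac_measure y)%:E = 1.
Proof.
under eq_esum => y _ do rewrite (kac_occupation y0).
rewrite esumZl; last 2 first.
- by rewrite lee_fin ltW// kac_measure_gt0.
- by move=> x; exact: occupation_ge0.
rewrite esum_occupation -(fineK (mean_return_fin y0)) -EFinM mulVf//.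
by rewrite gt_eqF// fine_mean_return_gt0.
Qed.

End KacMeasure.

(** * Additive sets of integers *)

(** The least positive difference [h] of two elements divides every element,
    so it is the gcd [g].  If [b] and [b + g] both belong to [S], with
    [b = c g], then a large multiple [n g] is a sum of copies of [b] and
    [b + g]: divide [n] by [c] and use the remainder as the number of
    [b + g]. *)
Lemma additive_eventually_multiples (S : set nat) (g : nat) :
  (forall m n, S m -> S n -> S (m + n)%N) ->
  (exists2 s, (0 < s)%N & S s) -> is_gcd S g ->
  exists N, forall n, (N <= n)%N -> S (n * g)%N.
Proof.
move=> SD [s s0 Ss] [gS Sg].
(* adjoining 0 makes [S] closed under multiples and lets [b = 0] occur *)
pose S0 n := n = 0%N \/ S n.
have S0D m n : S0 m -> S0 n -> S0 (m + n)%N.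
  move=> [->|Sm] [->|Sn]; rewrite ?addn0 ?add0n; [by left|by right|by right|].
  by right; exact: SD.
have S0M q m : S0 m -> S0 (q * m)%N.
  move=> Sm; elim: q => [|q IHq]; first by left.
  by rewrite mulSn; exact: S0D.
have gS0 n : S0 n -> (g %| n)%N by move=> [->|/gS].
pose D k := `[< (0 < k)%N /\ exists b, S0 b /\ S0 (b + k)%N >].
have exD : exists k, D k.
  exists s; apply/asboolP; split=> //; exists 0%N.
  by split; [left|rewrite add0n; right].
have [h /asboolP[h0 [b [Sb Sbh]]] hmin] := ex_minnP exD.
(* a remainder modulo the least difference [h] is again a difference *)
have hS n : S n -> (h %| n)%N.
  move=> Sn; apply: contraT; rewrite /dvdn -lt0n => r0.
  have : (h <= n %% h)%N.
    apply: hmin; apply/asboolP; split=> //.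
    exists (n %/ h * (b + h))%N; split; first exact: S0M.
    rewrite mulnDr -addnA -divn_eq addnC.
    by apply: S0D; [right|exact: S0M].
  by rewrite leqNgt ltn_pmod.
have gh : g = h.
  apply/eqP; rewrite eqn_dvd (Sg _ hS) andbT.
  by have := gS0 _ Sbh; rewrite dvdn_addr// gS0.
have /dvdnP[c bE] := gS0 _ Sb.
exists (c * c).+1 => n cn.
suff : S0 (n * g)%N.
  move=> [/eqP|//]; rewrite muln_eq0 gh => /orP[/eqP n0|/eqP h0E].
    by rewrite n0 in cn.
  by rewrite h0E in h0.
have [c0|c0] := posnP c.
  by apply: S0M; move: Sbh; rewrite bE c0 mul0n add0n gh.
have rq : (n %% c <= n %/ c)%N.
  rewrite (leq_trans (ltnW (ltn_pmod n c0)))// leq_divRL//.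
  exact: ltnW.
have -> : (n * g = (n %/ c - n %% c) * b + n %% c * (b + h))%N.
  rewrite mulnDr addnA -mulnDl subnK// bE -gh mulnA -mulnDl.
  by rewrite -divn_eq.
by apply: S0D; exact: S0M.
Qed.

(** * Periodicity classes *)

Section Classes.
Context {R : realType} {X : countType} {disp : measure_display}
  {Omega : measurableType disp} (W : randomWalk R X Omega).
Variables (d : nat) (C : 'I_d -> set X).
Hypothesis classes : periodicity_classes W C.
Local Open Scope ereal_scope.

Let p0 x y : 0 <= (p W x y)%:E := pE_ge0 W x y.
Hint Resolve p0 : core.

Lemma class_unique i j x : C i x -> C j x -> i = j.
Proof.
have [[_ tC _] _] := classes.
by move=> Cix Cjx; apply: tC => //; exists x.
Qed.

Lemma class_exists x : exists i, C i x.
Proof.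
have [[cC _ _] _] := classes.
have : [set: X] x by [].
by rewrite -cC => -[i _ Cix]; exists i.
Qed.

Lemma class_pn n i j x y : C i x -> C j y -> 0 < pn W n x y ->
  ((i + n) %% d)%N = j.
Proof.
have [_ step] := classes.
elim: n j y => [|n IHn] j y Cix Cjy; rewrite -pn_inT.
  have [yx|yx] := eqVneq y x; last by rewrite pn_in0_neq ?ltxx.
  move=> _; rewrite yx in Cjy; rewrite addn0 modn_small//.
  by rewrite (class_unique Cix Cjy).
move=> /pn_inS_gt0[u pu puy]; have [k Cku] := class_exists u.
rewrite pn_inT in pu; have kE := IHn _ _ Cix Cku pu.
rewrite lte_fin in puy.
rewrite -(class_unique (step _ _ _ Cku puy) Cjy) /= -kE addnS.
by rewrite -[in RHS]addn1 modnDml addn1.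
Qed.

(** The whole mass of a class moves to the next one in one step; going once
    around the cycle, all classes have the same mass. *)
Lemma class_mass t i : (forall x, 0 <= t x) -> invariant_measure W t ->
  (\esum_(x in C i) t x) *+ d = \esum_(x in setT) t x.
Proof.
move=> t0 ti; have [_ step] := classes.
have mass_step k : \esum_(x in C k) t x <= \esum_(x in C (ordS k)) t x.
  rewrite [leRHS](eq_esum (b := push W t)); last by move=> x _; rewrite ti.
  rewrite /push esum_exchange; last by move=> *; rewrite mule_ge0.
  apply: (@le_trans _ _ (\esum_(x in C k) \esum_(z in C (ordS k))
      (t x * (p W x z)%:E))); last exact: esum_subset.
  apply: le_esum => x Ckx; rewrite esumZl// -[leLHS]mule1 -(p_sum1 W x).
  rewrite (esumID (C (ordS k)))// !setTI [X in _ + X]esum1 ?adde0// => z nCz.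
  apply: ge0_le0_eq0 => //; rewrite lee_fin leNgt; apply/negP => pxz.
  by apply: nCz; exact: step Ckx pxz.
have mass_le k l : \esum_(x in C k) t x <= \esum_(x in C l) t x.
  have mass_iter n :
      \esum_(x in C k) t x <= \esum_(x in C (iter n (@ordS d) k)) t x.
    elim: n => [|n IHn]; first by [].
    exact: le_trans IHn (mass_step _).
  have iterE n : (iter n (@ordS d) k = (k + n) %% d :> nat)%N.
    elim: n => [|n IHn]; first by rewrite addn0 modn_small.
    by rewrite /= IHn addnS -addn1 modnDml addn1.
  have <- : iter (l + d - k) (@ordS d) k = l; last exact: mass_iter.
  apply: val_inj; rewrite /= iterE subnKC; last first.
    by rewrite (leq_trans (ltnW (ltn_ord k)))// leq_addl.
  by rewrite modnDr modn_small.
have massE k : \esum_(x in C k) t x = \esum_(x in C i) t x.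
  by apply/eqP; rewrite eq_le !mass_le.
rewrite [RHS](eq_esum
    (b := fun x => \sum_(k < d) if x \in C k then t x else 0)); last first.
  move=> x _; have [k Ckx] := class_exists x.
  rewrite (bigD1 k)//= mem_set// big1 ?adde0// => l lk.
  by rewrite memNset// => Clx; move: lk; rewrite (class_unique Clx Ckx) eqxx.
rewrite esum_sum; last by move=> x k _ _; case: ifP.
under eq_bigr => k _ do rewrite -esum_mkcond massE.
by rewrite sumr_const card_ord.
Qed.

End Classes.

(** * Limit superior of the transition probabilities *)

Section LimSup.
Context {R : realType} {X : countType} {disp : measure_display}
  {Omega : measurableType disp} (W : randomWalk R X Omega).
Local Open Scope ereal_scope.
Hypothesis irr : irreducible W.
Hypothesis mean_finite : forall y, mean_return W y < +oo.

Let p0 x y : 0 <= (p W x y)%:E := pE_ge0 W x y.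
Let pn0 n x y : 0 <= pn W n x y.
Proof. by rewrite -pn_inT pn_in_ge0. Qed.
Let pn1 n x y : pn W n x y <= 1.
Proof. by rewrite -pn_inT pn_in_le1. Qed.
Let pn_fin n x y : pn W n x y \is a fin_num.
Proof. by rewrite -pn_inT pn_in_fin. Qed.
Let stay0 A n x : 0 <= stay_prob W A n x := stay_prob_ge0 W A n x.
Hint Resolve p0 pn0 pn1 pn_fin stay0 : core.

Lemma pnD m n x y :
  pn W (m + n) x y = \esum_(z in setT) (pn W m x z * pn W n z y).
Proof.
by rewrite -pn_inT pn_inD; apply: eq_esum => z _; rewrite !pn_inT.
Qed.

Lemma esum_pn n x : \esum_(z in setT) pn W n x z = 1.
Proof.
rewrite (eq_esum (b := pn_in W setT n x)); last by move=> z _; rewrite pn_inT.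
rewrite -stay_probE /stay_prob (_ : stays W setT n = setT) ?probability_setT//.
by apply/seteqP; split.
Qed.

Lemma pn_gt0D m n x y z : 0 < pn W m x y -> 0 < pn W n y z ->
  0 < pn W (m + n) x z.
Proof.
move=> pxy pyz; rewrite pnD; apply: lt_le_trans (mule_gt0 pxy pyz) _.
apply: (@esum_ge_term _ _ _ (fun y => _ * pn W n y z)) => // u _.
by rewrite mule_ge0.
Qed.

Variable y : X.

Definition limsup_return : R := fine (limn_esup (fun n => pn W n y y)).

Lemma limsup_returnE : limn_esup (fun n => pn W n y y) = limsup_return%:E.
Proof.
rewrite fineK// fin_numE; apply/andP; split.
  rewrite gt_eqF// (@lt_le_trans _ _ 0)//.
  by apply: limn_esup_ge_frequently => N; exists N.
rewrite lt_eqF// (@le_lt_trans _ _ 1) ?ltry//.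
by apply: limn_esup_le_near; exact: nearW.
Qed.

Lemma limsup_return_ge0 : (0 <= limsup_return)%R.
Proof.
rewrite -lee_fin -limsup_returnE.
by apply: limn_esup_ge_frequently => N; exists N.
Qed.

(** From every state the walk reaches [y] within [k] steps up to probability
    [miss_prob W y k x], and is then governed by the upper limit at [y].  The
    induction on [k] applies the reverse Fatou inequality to one step. *)
Lemma limn_esup_pn_le x : limn_esup (fun n => pn W n x y) <= limsup_return%:E.
Proof.
have l0 : 0 <= limsup_return%:E by rewrite lee_fin limsup_return_ge0.
have by_miss k z :
    limn_esup (fun n => pn W n z y) <= limsup_return%:E + miss_prob W y k z.
  elim: k z => [|k IHk] z.
    rewrite /miss_prob stay_prob0; apply: limn_esup_le_near; apply: nearW => n.
    by rewrite (le_trans (pn1 _ _ _))// leeDr.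
  pose b u := limsup_return%:E +
    (if u \in ~` [set y] then miss_prob W y k u else 0).
  have b0 u : 0 <= b u by rewrite adde_ge0//; case: ifP.
  apply: (le_trans (limn_esup_shift _ 1)).
  rewrite (_ : (fun n => _) =
      fun n => \esum_(u in setT) ((p W z u)%:E * pn W n u y)); last first.
    apply/funext => n; rewrite addn1 -add1n pnD; apply: eq_esum => u _.
    by rewrite -[in LHS]pn_inT pn_in1.
  apply: (le_trans (limn_esup_esum_le (b := b) _ _ _ _ _)) => //.
  - by rewrite p_sum1 ltry.
  - by move=> n u; rewrite pn0 pn1.
  - move=> u; rewrite /b; case: ifPn => [_|/negP uy]; first exact: IHk.
    rewrite adde0 (_ : u = y) ?limsup_returnE//.
    by apply: contrapT => yu; apply: uy; rewrite mem_set.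
  rewrite /b (eq_esum (b := fun u => (p W z u)%:E * limsup_return%:E +
      (if u \in ~` [set y] then (p W z u)%:E * miss_prob W y k u else 0))).
    rewrite esumD; last 2 first.
    - by move=> u _; rewrite mule_ge0.
    - by move=> u _; case: ifP => // _; rewrite mule_ge0.
    rewrite -esum_mkcond /miss_prob stay_probS leeD2r//.
    under eq_esum => u _ do rewrite muleC.
    by rewrite esumZl// p_sum1 mule1.
  move=> u _; rewrite ge0_muleDr//; last by case: ifP.
  by congr (_ + _); case: ifP => //; rewrite mule0.
apply/lee_addgt0Pr => e e0.
have : limn_esup (fun k => miss_prob W y k x) < e%:E.
  apply: le_lt_trans (limn_esup_miss_prob x irr (mean_finite y)) _.
  by rewrite lte_fin.
move=> /near_lt_limn_esup[k _ /(_ k (leqnn k)) /= /ltW small].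
by apply: le_trans (by_miss k x) _; rewrite leeD2l.
Qed.


Lemma frequently_return e N : (0 < e)%R ->
  exists2 n, (N <= n)%N & (limsup_return - e)%:E < pn W n y y.
Proof.
move=> e0; apply: frequently_lt_limn_esup.
by rewrite limsup_returnE lte_fin ltrBlDr ltrDl.
Qed.

(** [p^(m+n)(y,y)] is an average, with weight [c = p^(m)(y,z)] on
    [p^(n)(z,y)]; all the other averaged terms are asymptotically at most the
    upper limit [l], so a deficit of [e] at [z] costs [c e] in the average.
    The integer [j] serves both as a rank and, through [1 / (j + 1)], as a
    tolerance, so that finitely many such statements can be combined. *)
Lemma near_limsup_propagates m z e : 0 < pn W m y z -> (0 < e)%R ->
  \forall j \near \oo, forall n, (j <= n)%N ->
    (limsup_return - j.+1%:R^-1)%:E < pn W (m + n) y y ->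
    (limsup_return - e)%:E <= pn W n z y.
Proof.
set l := limsup_return; move=> c0 e0; pose c := fine (pn W m y z).
have cE : pn W m y z = c%:E by rewrite fineK.
rewrite cE lte_fin in c0.
pose w u := if u \in ~` [set z] then pn W m y u else 0.
have w0 u : 0 <= w u by rewrite /w; case: ifP.
have sw : \esum_(u in setT) w u = (1 - c)%:E.
  rewrite -esum_mkcond; have := esum_pn m y; rewrite (esum_split z)// cE => E.
  by rewrite EFinB -E [X in X - _]addeC addeK.
have ce0 : (0 < c * e / 2)%R by rewrite divr_gt0// mulr_gt0.
have : limn_esup (fun n => \esum_(u in setT) (w u * pn W n u y)) <
    ((1 - c) * l + c * e / 2)%:E.
  apply: (@le_lt_trans _ _ (\esum_(u in setT) (w u * l%:E))).
    apply: limn_esup_esum_le => //; first by rewrite sw ltry.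
    - by move=> n u; rewrite pn0 pn1.
    - by move=> u; rewrite lee_fin limsup_return_ge0.
    - exact: limn_esup_pn_le.
  under eq_esum => u _ do rewrite muleC.
  rewrite esumZl//; last by rewrite lee_fin limsup_return_ge0.
  by rewrite sw -EFinM lte_fin mulrC ltrDl.
move=> /near_lt_limn_esup[N _ wN].
near=> j => n jn.
have Nn : (N <= n)%N by apply: leq_trans jn; near: j; exact: nbhs_infty_ge.
have jsmall : (j.+1%:R^-1 < c * e / 2)%R.
  by near: j; exact: near_infty_natSinv_lt (PosNum ce0).
(* now [l - c e / 2 < c v + (1 - c) l + c e / 2], that is, [c (l - e) < c v] *)
have := wN n Nn => /=; rewrite pnD (esum_split z); last first.
  by move=> u; rewrite mule_ge0.
have [v vE] : exists v, pn W n z y = v%:E.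
  by exists (fine (pn W n z y)); rewrite fineK.
rewrite cE vE -EFinM.
have -> : \esum_(u in ~` [set z]) (pn W m y u * pn W n u y) =
    \esum_(u in setT) (w u * pn W n u y).
  rewrite esum_mkcond; apply: eq_esum => u _; rewrite /w.
  by case: ifP => //; rewrite mul0e.
set s := \esum_(u in _) _ => s_lt lt_s.
have := lt_le_trans lt_s (leeD2l _ (ltW s_lt)).
rewrite -EFinD lte_fin lee_fin => lt_v.
move: (_^-1)%R jsmall lt_v => a a_small lt_v; rewrite -(ler_pM2l c0).
by lra.
Unshelve. all: by end_near. Qed.

Lemma frequently_near_limsup z e N : (0 < e)%R ->
  exists2 n, (N <= n)%N & (limsup_return - e)%:E <= pn W n z y.
Proof.
move=> e0; have [m pm] := irr y z.
have [j _ /(_ j (leqnn j)) /= jP] := near_limsup_propagates pm e0.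
have j0 : (0 < j.+1%:R^-1 :> R)%R by rewrite invr_gt0.
have [n' n'_ge lt_n'] := frequently_return (m + maxn j N) j0.
have mn' : (m <= n')%N by rewrite (leq_trans _ n'_ge)// leq_addr.
have n'm : (maxn j N <= n' - m)%N by rewrite leq_subRL.
move: n'm; rewrite geq_max => /andP[jn Nn].
by exists (n' - m)%N => //; apply: jP => //; rewrite subnKC.
Qed.

(** The common number [m] of steps from [y] is essential: a single near-maximal
    time [m + n] for returning to [y] serves all [z] in [F]. *)
Lemma simultaneously_near_limsup (F : set X) m e : finite_set F ->
  (forall z, F z -> 0 < pn W m y z) -> (0 < e)%R ->
  exists n, forall z, F z -> (limsup_return - e)%:E <= pn W n z y.
Proof.
move=> finF Fm e0.
have := near_finite_set finF
  (fun z Fz => near_limsup_propagates (Fm z Fz) e0).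
move=> [j _ /(_ j (leqnn j)) /= jP].
have j0 : (0 < j.+1%:R^-1 :> R)%R by rewrite invr_gt0.
have [n' n'_ge lt_n'] := frequently_return (m + j) j0.
have mn' : (m <= n')%N by rewrite (leq_trans _ n'_ge)// leq_addr.
by exists (n' - m)%N => z Fz; apply: jP => //; rewrite ?leq_subRL ?subnKC.
Qed.

Lemma exists_return : exists2 n, (1 <= n)%N & 0 < pn W n y y.
Proof.
have [u pyu] : exists u, 0 < (p W y u)%:E.
  apply: contrapT => /forallNP nou; have := p_sum1 W y; rewrite esum1.
    by move/eqP; rewrite eq_sym onee_eq0.
  by move=> u _; apply: ge0_le0_eq0 => //; rewrite leNgt; apply/negP.
have [n pn_uy] := irr u y; exists (1 + n)%N => //.
by apply: pn_gt0D pn_uy; rewrite -pn_inT pn_in1.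
Qed.

Section Periodic.
Variables (d : nat) (C : 'I_d -> set X).
Hypothesis period : is_period W d.
Hypothesis classes : periodicity_classes W C.
Variable j : 'I_d.
Hypothesis Cjy : C j y.

Let d0 : (0 < d)%N := leq_ltn_trans (leq0n j) (ltn_ord j).

Lemma class_reach z : C j z -> \forall k \near \oo, 0 < pn W (k * d) y z.
Proof.
move=> Cjz; have [n pn_yz] := irr y z.
have /dvdnP[q nE] : (d %| n)%N.
  have := class_pn classes Cjy Cjz pn_yz.
  rewrite -[in RHS](modn_small (ltn_ord j)) -[in RHS](addn0 j) => /eqP.
  by rewrite eqn_modDl mod0n.
have [N NP] : exists N, forall k, (N <= k)%N ->
    [set k | (1 <= k)%N /\ 0 < pn W k y y] (k * d)%N.
  apply: additive_eventually_multiples.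
  - move=> k l [k1 pk] [l1 pl]; split; first by rewrite addn_gt0 k1.
    exact: pn_gt0D pl.
  - by have [k k1 pk] := exists_return; exists k.
  - exact: period.
exists (N + q)%N => // k /= Nqk.
have qk : (q <= k)%N by rewrite (leq_trans _ Nqk)// leq_addl.
rewrite -(subnK qk) mulnDl; apply: (@pn_gt0D _ _ _ y); last by rewrite -nE.
by have [] := NP (k - q)%N; rewrite ?leq_subRL// addnC.
Qed.

Notation mu := (kac_measure W).

Let mu0 x : 0 <= (mu x)%:E.
Proof. by rewrite lee_fin ltW// kac_measure_gt0. Qed.
Let mu_inv : invariant_measure W (EFin \o mu).
Proof. exact: invariant_kac_measure. Qed.
Let mu_sum : \esum_(x in setT) (mu x)%:E = 1.
Proof. exact: esum_kac_measure. Qed.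
Hint Resolve mu0 : core.

Lemma class_kac_mass : \esum_(x in C j) (mu x)%:E = (d%:R^-1)%:E.
Proof.
have := class_mass classes j mu0 mu_inv; rewrite mu_sum.
have fin : \esum_(x in C j) (mu x)%:E \is a fin_num.
  rewrite ge0_fin_numE ?esum_ge0//.
  apply: (@le_lt_trans _ _ 1); last exact: ltry.
  by rewrite -mu_sum; exact: esum_subset.
rewrite -(fineK fin) -mule_natl -EFinM => E; congr EFin.
have {}E := EFin_inj E.
have dn0 : (d%:R != 0 :> R)%R by rewrite pnatr_eq0 -lt0n.
by apply: (mulfI dn0); rewrite E mulfV.
Qed.

(** In [sum_x mu(x) p^(nd)(x,y) = mu(y)] only the states of the class of [y]
    contribute. *)
Lemma kac_measure_le_limsup : (mu y)%:E <= (d%:R^-1 * limsup_return)%:E.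
Proof.
pose w x := if x \in C j then (mu x)%:E else 0.
have w0 x : 0 <= w x by rewrite /w; case: ifP.
have sw : \esum_(x in setT) w x = (d%:R^-1)%:E.
  by rewrite -esum_mkcond class_kac_mass.
have avg n : \esum_(x in setT) (w x * pn W (n * d) x y) = (mu y)%:E.
  rewrite -(invariant_pn (n * d) y mu0 mu_inv); apply: eq_esum => x _.
  rewrite /w; case: ifPn => // /negP nCx; rewrite mul0e; apply/esym.
  rewrite [X in _ * X](_ : _ = 0) ?mule0//.
  apply: ge0_le0_eq0 => //; rewrite leNgt; apply/negP => pxy; apply: nCx.
  have [i Cix] := class_exists classes x.
  have := class_pn classes Cix Cjy pxy.
  rewrite addnC modnMDl modn_small// => ij.
  by rewrite mem_set// -(ord_inj ij).
have -> : (d%:R^-1 * limsup_return)%:E =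
    \esum_(x in setT) (w x * limsup_return%:E).
  under eq_esum => x _ do rewrite muleC.
  by rewrite esumZl// ?lee_fin ?limsup_return_ge0// sw -EFinM mulrC.
apply: (@le_trans _ _
    (limn_esup (fun n => \esum_(x in setT) (w x * pn W (n * d) x y)))).
  by apply: limn_esup_ge_frequently => N; exists N => //; rewrite avg.
apply: limn_esup_esum_le => //; first by rewrite sw ltry.
- by move=> n x; rewrite pn0 pn1.
- by move=> x; rewrite lee_fin limsup_return_ge0.
- move=> x; apply: le_trans (limn_esup_pn_le x).
  apply: (limn_esup_subseq (fun n => pn W n x y) (f := fun n => n * d)%N) => N.
  by exists N => // n /= Nn; rewrite (leq_trans Nn)// leq_pmulr.
Qed.

(** On a finite part of the class of [y], all [p^(n)(x,y)] are at once close to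
    the upper limit, for suitable [n]; by invariance their [mu]-average is at
    most [mu(y)]. *)
Lemma limsup_le_kac_measure : (d%:R^-1 * limsup_return)%:E <= (mu y)%:E.
Proof.
have l0 : 0 <= limsup_return%:E by rewrite lee_fin limsup_return_ge0.
rewrite mulrC EFinM -class_kac_mass -esumZl//.
apply: ge_ereal_sup => _ [F [finF FC] <-].
apply/lee_addgt0Pr => e e0; have eE0 : 0 <= e%:E by rewrite lee_fin ltW.
have [M _ /(_ M (leqnn M)) /= FM] :
    \forall k \near \oo, forall z, F z -> 0 < pn W (k * d) y z.
  by apply: near_finite_set => // z /FC; exact: class_reach.
have [n nP] := simultaneously_near_limsup finF FM e0.
rewrite -esum_fset//; last by move=> x _; rewrite mule_ge0.
apply: (@le_trans _ _
    (\esum_(x in F) ((mu x)%:E * pn W n x y + e%:E * (mu x)%:E))).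
  apply: le_esum => x Fx; rewrite muleC (muleC e%:E) -ge0_muleDr//.
  have := nP x Fx; rewrite EFinB leeBlDr// => le_l.
  by rewrite lee_pmul.
rewrite esumD; last 2 first.
- by move=> x _; rewrite mule_ge0.
- by move=> x _; rewrite mule_ge0.
apply: leeD.
  by rewrite -(invariant_pn n y mu0 mu_inv); exact: esum_subset.
rewrite esumZl// -[leRHS]mule1 lee_pmul ?esum_ge0// -mu_sum.
exact: esum_subset.
Qed.

Lemma kac_measure_limsup : mu y = (d%:R^-1 * limsup_return)%R.
Proof.
apply/eqP; rewrite eq_le -!lee_fin.
by rewrite kac_measure_le_limsup limsup_le_kac_measure.
Qed.

(** The walk from [x] can be at [y] only at times of the form [n d + j - i], so
    restricting to these times does not lower the upper limit. *)
Lemma limn_esup_class i x : C i x ->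
  limn_esup (fun n => pn W (n * d + j - i)%N x y) = limsup_return%:E.
Proof.
move=> Cix; apply/eqP; rewrite eq_le; apply/andP; split.
  apply: le_trans (limn_esup_pn_le x).
  apply: (limn_esup_subseq (fun n => pn W n x y)
    (f := fun n => n * d + j - i)%N) => N.
  (* the shift is needed as [j - i] can be as low as [1 - d] *)
  exists N.+1 => // n /= Nn.
  rewrite leq_subRL; last first.
    rewrite (leq_trans (ltnW (ltn_ord i)))//.
    by rewrite (leq_trans _ (leq_addr _ _))// leq_pmull// (leq_trans _ Nn).
  rewrite (leq_trans _ (leq_addr _ _))//.
  rewrite (@leq_trans (N.+1 * d))//; last by rewrite leq_mul2r Nn orbT.
  by rewrite mulSn leq_add// ?leq_pmulr// ltnW.
apply/lee_addgt0Pr => e e0.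
have [el|le_e] := ltP e limsup_return; last first.
  apply: (@le_trans _ _ (0 + e%:E)); first by rewrite add0e lee_fin.
  by rewrite leeD2r//; apply: limn_esup_ge_frequently => N; exists N.
rewrite -leeBlDr// -EFinB; apply: limn_esup_ge_frequently => N.
have [n Nn le_n] := frequently_near_limsup x (N * d) e0.
have pxy : 0 < pn W n x y.
  by apply: lt_le_trans le_n; rewrite lte_fin subr_gt0.
have ij := class_pn classes Cix Cjy pxy.
exists ((i + n) %/ d)%N.
  by rewrite leq_divRL// (leq_trans Nn)// leq_addl.
by rewrite -ij -divn_eq addKn.
Qed.

End Periodic.
End LimSup.

Theorem theorem3p2 (R : realType) (X : countType) (disp : measure_display)
    (Omega : measurableType disp) (W : randomWalk R X Omega)
    (X_nonempty : [set: X] !=set0) (W_irr : irreducible W) :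
  ((exists nu : X -> R,
      [/\ finite_variation nu, stationary W nu & exists x, nu x != 0])
   <-> positive_recurrent W)
  /\
  (positive_recurrent W ->
   exists mu : X -> R,
     (forall (d : nat) (C : 'I_d -> set X),
        is_period W d -> periodicity_classes W C ->
        forall (i j : 'I_d) (x y : X), C i x -> C j y ->
          (mu y)%:E =
          ((d%:R^-1)%:E * limn_esup (fun n => pn W (n * d + j - i)%N x y))%E)
     /\
     (forall nu : X -> R,
        finite_variation nu -> stationary W nu -> (exists x, nu x != 0) ->
        exists alpha : R, alpha != 0 /\ forall y, nu y = alpha * mu y)).
Proof.
have [y0 _] := X_nonempty.
split; [split|].
- move=> [nu [fv st nu0]]; apply/positive_recurrentE => y.
  exact: mean_return_finite_of_stationary st nu0 y.
- move=> /positive_recurrentE m.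
  have mu0 y : (0 <= (kac_measure W y)%:E)%E.
    by rewrite lee_fin ltW// kac_measure_gt0.
  have mu_inv := invariant_kac_measure W_irr m y0.
  have [|fv st] := stationary_of_invariant mu0 _ mu_inv.
    by rewrite esum_kac_measure// ltry.
  exists (kac_measure W); split=> //; exists y0.
  by rewrite gt_eqF ?kac_measure_gt0.
- move=> /positive_recurrentE m; exists (kac_measure W); split.
    move=> d C period classes i j x y Cix Cjy.
    rewrite (limn_esup_class W_irr m classes Cjy Cix).
    by rewrite (kac_measure_limsup W_irr m period classes Cjy) EFinM.
  move=> nu fv st [x nux]; have [alpha nuE] := stationary_kac W_irr m fv st.
  exists alpha; split=> //; apply: contraNneq nux => alpha0.
  by rewrite nuE alpha0 mul0r.
Qed.
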